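(* (1) Let $f$ be a Strongly Log-Concave entire function on $\mathbb{C}^n$ with nonnegative Taylor coefficients. Then $$\mathrm{Cap}(f)\ge \frac{\partial^n f}{\partial x_1\cdots\partial x_n}(0)\ge e^{-n}\mathrm{Cap}(f).$$ (2) Let $p$ be a Strongly Log-Concave homogeneous polynomial of degree $n$ in $n$ variables with nonnegative coefficients. Then $$\mathrm{Cap}(p)\ge \frac{\partial^n p}{\partial x_1\cdots\partial x_n}(0)\ge \frac{n!}{n^n}\mathrm{Cap}(p).$$ (3) Let $p$ be a Strongly Log-Concave polynomial in $n$ variables of total degree $n$ with nonnegative coefficients. Then $$\mathrm{Cap}(p)\ge \frac{\partial^n p}{\partial x_1\cdots\partial x_n}(0)\ge \Big(\prod_{i=1}^n L(i)\Big)\mathrm{Cap}(p),$$ where $L(k)=\left(\inf_{t>0}\frac{\exp_k(t)}{t}\right)^{-1}$ and $\exp_k(t)=\sum_{j=0}^k\frac{t^j}{j!}$.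
   Context: $\mathrm{Cap}(h)=\inf_{x_1,\dots,x_n>0}\frac{h(x_1,\dots,x_n)}{\prod_{i=1}^n x_i}$. A function $g\ge 0$ on $\mathbb{R}_+^n$ ($\mathbb{R}_+=[0,\infty)$) is log-concave if $g(\lambda x+(1-\lambda)y)\ge g(x)^\lambda g(y)^{1-\lambda}$. An entire function (or polynomial) $f$ with nonnegative Taylor coefficients is Strongly Log-Concave if for every $(c_1,\dots,c_n)\in\mathbb{Z}_+^n$ the function $\partial_{x_1}^{c_1}\cdots\partial_{x_n}^{c_n}f$ is either identically zero or log-concave on $\mathbb{R}_+^n$. *)

(* Defs.v *)
From HB Require Import structures.
From mathcomp Require Import all_boot all_order all_algebra finmap.
(* The notations of mpoly clash with those of MathComp-Analysis. *)
From mathcomp Require Import -(notations) mpoly.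
From mathcomp Require Import complex.
From mathcomp Require Import all_classical all_reals all_analysis.
From mathcomp Require Import summability.

Set Implicit Arguments.
Unset Strict Implicit.
Unset Printing Implicit Defensive.

Import Order.TTheory GRing.Theory Num.Theory.
Import numFieldNormedType.Exports.

Local Open Scope classical_set_scope.
Local Open Scope ring_scope.
Local Open Scope complex_scope.

Definition Cap (R : realType) (n : nat) (h : 'rV[R]_n -> R) : R :=
  inf [set h x / (\prod_(i < n) x 0 i) |
        x in [set x : 'rV[R]_n | forall i, 0 < x 0 i]].

Definition nneg_orthant (R : realType) (n : nat) : set 'rV[R]_n :=
  [set x | forall i, 0 <= x 0 i].

(* [powR] satisfies 0 `^ 0 = 1 and 0 `^ a = 0 for a > 0, so the inequality is
   the intended one also at zeros of g and for lambda = 0 or 1. *)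
Definition log_concave (R : realType) (n : nat) (g : 'rV[R]_n -> R) : Prop :=
  (forall x, nneg_orthant x -> 0 <= g x) /\
  (forall (x y : 'rV[R]_n) (lambda : R),
     nneg_orthant x -> nneg_orthant y -> 0 <= lambda <= 1 ->
     g x `^ lambda * g y `^ (1 - lambda)
       <= g (lambda *: x + (1 - lambda) *: y)).

Definition ones (n : nat) : multinom n := Multinom [tuple 1%N | i < n].

(* R[i]^o rather than R[i], because only the former carries the normed-module
   structure required by convergence and derivatives. *)
Definition monomial (R : realType) (n : nat) (c : multinom n)
    (z : 'rV[R[i]]_n) : R[i]^o :=
  \prod_(i < n) z 0 i ^+ c i.

(* Holomorphy in several variables in the sense of Weierstrass: near w, f is
   the sum of a power series centred at w. Convergence is along the finite sets
   of multi-indices directed by inclusion, i.e., it is unconditional. *)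
Definition holomorphic_at (R : realType) (n : nat)
    (f : 'rV[R[i]]_n -> R[i]^o) (w : 'rV[R[i]]_n) : Prop :=
  exists2 r : R, 0 < r & exists a : multinom n -> R[i]^o,
    forall z : 'rV[R[i]]_n, (forall i, `|z 0 i - w 0 i| < r%:C) ->
      partial_sum (fun c => a c * monomial c (z - w)) @ totally --> f z.

Definition entire (R : realType) (n : nat) (f : 'rV[R[i]]_n -> R[i]^o) : Prop :=
  forall w, holomorphic_at f w.

Definition partial (R : realType) (n : nat) (i : 'I_n)
    (f : 'rV[R[i]]_n -> R[i]^o) : 'rV[R[i]]_n -> R[i]^o :=
  fun z => 'D_('e_i) f z.

Definition partials (R : realType) (n : nat) (c : multinom n)
    (f : 'rV[R[i]]_n -> R[i]^o) : 'rV[R[i]]_n -> R[i]^o :=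
  foldr (fun i g => iter (c i) (partial i) g) f (enum 'I_n).

Definition taylor_coef (R : realType) (n : nat)
    (f : 'rV[R[i]]_n -> R[i]^o) (c : multinom n) : R[i] :=
  partials c f 0 / (\prod_(i < n) (c i)`!)%:R.

(* An entire function with nonnegative Taylor coefficients, and each of its
   partial derivatives, is real on R^n, so taking real parts loses nothing. *)
Definition real_restriction (R : realType) (n : nat)
    (f : 'rV[R[i]]_n -> R[i]^o) : 'rV[R]_n -> R :=
  fun x => complex.Re (f (map_mx (real_complex R) x)).

Definition strongly_log_concave (R : realType) (n : nat)
    (f : 'rV[R[i]]_n -> R[i]^o) : Prop :=
  forall c : multinom n,
    (forall z, partials c f z = 0) \/
    log_concave (real_restriction (partials c f)).

Definition poly_fun (R : realType) (n : nat) (p : mpoly n R) : 'rV[R]_n -> R :=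
  fun x => meval (fun i => x 0 i) p.

Definition poly_strongly_log_concave (R : realType) (n : nat)
    (p : mpoly n R) : Prop :=
  forall c : multinom n,
    mderivm c p = 0 \/ log_concave (poly_fun (mderivm c p)).

Definition exp_trunc (R : realType) (k : nat) (t : R) : R :=
  \sum_(j < k.+1) t ^+ j / j`!%:R.

Definition Lconst (R : realType) (k : nat) : R :=
  (inf [set exp_trunc k t / t | t in [set t : R | 0 < t]])^-1.

(* Main.v *)
Require Import Defs.
From HB Require Import structures.
From mathcomp Require Import all_boot all_order all_algebra finmap.
From mathcomp Require Import -(notations) mpoly.
From mathcomp Require Import complex.
From mathcomp Require Import all_classical all_reals all_analysis.
From mathcomp Require Import summability.
From mathcomp Require Import ring lra.

(* Let G_k(x) be the derivative of f in each of the variables x_k, ..., x_{n-1},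
   evaluated at (x_0, ..., x_{k-1}, 0, ..., 0); then G_n = f and G_0 is the mixed
   derivative at 0. In its last variable, G_{k+1} is a function g on [0, oo)
   all of whose derivatives are nonnegative and log-concave, and g'(0) = G_k.
   Convexity gives g(t) >= g'(0) t, which yields the upper bound. For the lower
   bound one bounds g(t) from above in terms of a = g(0) and b = g'(0) and
   optimises over t: by a exp(b t / a) in general, by a exp_k(b t / a) if g is a
   polynomial of degree at most k, and by a (1 + b t / (k a)) ^ k if g comes from
   a form of degree k. Only the existence of iterated partial derivatives is
   needed of an entire function, not its global Taylor expansion. *)

Set Implicit Arguments.
Unset Strict Implicit.
Unset Printing Implicit Defensive.

Import Order.TTheory GRing.Theory Num.Theory.
Import numFieldNormedType.Exports.

Local Open Scope classical_set_scope.
Local Open Scope ring_scope.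
Local Open Scope complex_scope.

(** * Log-concave functions on a half-line *)

Section Univariate.
Variable R : realType.
Implicit Types (f g : R -> R) (h : nat -> R -> R).

(** A negative derivative would make Caratheodory's slope function negative just to the right of
    [a]. The one-sided form is what the end point 0 of the half-line requires. *)
Lemma right_min_derive_ge0 f (a b d : R) :
  a < b -> is_derive a 1 f d -> (forall x, a < x < b -> f a <= f x) -> 0 <= d.
Proof.
move=> ab /is_derive1_caratheodory[g [fE gc gd]] fmin.
rewrite leNgt; apply/negP => d0.
have g0 : \forall z \near a, g z < 0.
  by have := cvgr_lt (g a) gc; apply; rewrite gd.
have /(@filter_ex _ _ (at_right_proper_filter a))[z [gz az zb]] :
  \forall z \near a^'+, [/\ g z < 0, a < z & z < b].
  near=> z; split.
  - by near: z; apply: cvg_within; exact: g0.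
  - by near: z; exact: nbhs_right_gt.
  - by near: z; exact: nbhs_right_lt.
have := fmin z; rewrite az zb => /(_ isT).
by rewrite -subr_ge0 fE pmulr_lge0 ?subr_gt0// leNgt gz.
Unshelve. all: by end_near. Qed.

Lemma ndecr_of_derive_ge0 f g :
  (forall t : R, is_derive t 1 f (g t)) -> (forall t : R, 0 <= t -> 0 <= g t) ->
  forall t u : R, 0 <= t -> t <= u -> f t <= f u.
Proof.
move=> fg g0 t u t0 tu.
have [|c] := @MVT_segment _ f g t u tu (fun x _ => fg x).
  apply/continuous_subspaceT => x.
  exact/differentiable_continuous/derivable1_diffP.
rewrite in_itv/= => /andP[tc _] e; rewrite -subr_ge0 e.
by rewrite mulr_ge0 ?subr_ge0// g0// (le_trans t0).
Qed.

(* Log-concavity gives [f 0 * (1 + l * ln (f 1 / f 0)) <= f l], with equality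
   at [l = 0]; compare the slopes there. *)
Lemma log_concave_tangent f (d : R) :
  is_derive (0 : R) 1 f d -> 0 < f 0 -> 0 <= f 1 ->
  (forall l : R, 0 <= l <= 1 -> f 1 `^ l * f 0 `^ (1 - l) <= f l) ->
  f 1 <= f 0 * expR (d / f 0).
Proof.
move=> fd f0; rewrite le_eqVlt => /predU1P[<- _|f1 lc].
  by rewrite mulr_ge0 ?expR_ge0// ltW.
set k := ln (f 1) - ln (f 0).
have fl (l : R) : 0 <= l <= 1 -> f 0 * (1 + l * k) <= f l.
  move=> l01; apply: le_trans (lc l l01).
  rewrite /powR !gt_eqF// -expRD.
  have -> : l * ln (f 1) + (1 - l) * ln (f 0) = ln (f 0) + l * k.
    by rewrite /k; ring.
  by rewrite expRD lnK ?posrE// ler_pM2l// expR_ge1Dx.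
have dk : 0 <= d - f 0 * k.
  apply: (@right_min_derive_ge0 (fun l => f l - f 0 * (1 + l * k)) 0 1) => //.
    apply: is_derive_eq.
    rewrite /GRing.scale/=; ring.
  move=> l /andP[l0 l1]; rewrite mul0r addr0 mulr1 subrr subr_ge0.
  by rewrite fl// !ltW.
have kd : k <= d / f 0 by rewrite ler_pdivlMr// mulrC -subr_ge0.
have : expR k <= expR (d / f 0) by rewrite ler_expR.
rewrite -(ler_pM2l f0) => H; apply: le_trans H; rewrite /k.
by rewrite expRD expRN !lnK ?posrE// mulrCA divff ?mulr1// gt_eqF.
Qed.

Definition log_concave_ray f :=
  (forall t : R, 0 <= t -> 0 <= f t) /\
  (forall a b l : R, 0 <= a -> 0 <= b -> 0 <= l <= 1 ->
     f a `^ l * f b `^ (1 - l) <= f (l * a + (1 - l) * b)).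

(** The segment from [t] to [u] is parametrised by the unit interval. [u] may lie on either side of
    [t], which [log_derivative_le] exploits. *)
Lemma log_concave_ray_tangent f (t u d : R) :
  log_concave_ray f -> is_derive t 1 f d -> 0 <= t -> 0 <= u -> 0 < f t ->
  f u <= f t * expR (d / f t * (u - t)).
Proof.
move=> [f0 lc] fd t0 u0 ft.
pose w l := t + l * (u - t).
have w0 : w 0 = t by rewrite /w mul0r addr0.
have w1 : w 1 = u by rewrite /w mul1r addrC subrK.
have := @log_concave_tangent (f \o w) (d * (u - t)).
rewrite /= w0 w1 mulrAC; apply => //; last 2 first.
- exact: f0.
- move=> l l01; have -> : w l = l * u + (1 - l) * t by rewrite /w; ring.
  exact: lc.
apply: is_derive1_comp; first by rewrite w0.
apply: is_derive_eq.
rewrite /GRing.scale/=; ring.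
Qed.

(** * Functions with log-concave derivatives of all orders *)

Section DerivativeSequence.
Variable h : nat -> R -> R.
Hypothesis h_lc : forall j, log_concave_ray (h j).
Hypothesis h_derive : forall j (t : R), is_derive t 1 (h j) (h j.+1 t).

Lemma h_ge0 j t : 0 <= t -> 0 <= h j t.
Proof. by move=> t0; apply: (h_lc j).1. Qed.

Lemma h_ndecr j t u : 0 <= t -> t <= u -> h j t <= h j u.
Proof. by apply: (ndecr_of_derive_ge0 (h_derive j)) => *; apply: h_ge0. Qed.

(** The difference has derivative [h 1 s - h 1 0], which is nonnegative because [h 1] is
    nondecreasing. *)
Lemma linear_term_le t : 0 <= t -> h 1 0 * t <= h 0 t.
Proof.
move=> t0; rewrite -subr_ge0.
have d (s : R) : is_derive s 1 (fun s => h 0 s - h 1 0 * s) (h 1 s - h 1 0).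
  apply: is_derive_eq; rewrite /GRing.scale/=; ring.
have d0 s : 0 <= s -> 0 <= h 1 s - h 1 0 by move=> s0; rewrite subr_ge0 h_ndecr.
apply: le_trans (ndecr_of_derive_ge0 d d0 (lexx 0) t0).
by rewrite mulr0 subr0 h_ge0.
Qed.

(** The degenerate case of the steps below, which otherwise divide by [h 0 0]. Here the constant 1
    works, and the constants of all three steps are at most 1. *)
Lemma slope_le_of_zero C :
  h 0 0 = 0 -> (forall t : R, 0 < t -> C * t <= h 0 t) -> C <= h 1 0.
Proof.
move=> h0 Ch; rewrite -subr_ge0.
apply: (@right_min_derive_ge0 (fun t => h 0 t - C * t) 0 1) => //.
  apply: is_derive_eq; rewrite /GRing.scale/=; ring.
by move=> t /andP[t0 _]; rewrite h0 mulr0 subrr subr_ge0 Ch.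
Qed.

(** Substituting [t = s * a0 / a1] removes [a0] from the bound. If [a1 = 0], the assumed upper bound
    is constant in [t], which forces [C = 0]. *)
Lemma scale_bound (a0 a1 C : R) (E : R -> R) :
  0 < a0 -> 0 <= a1 -> 0 <= C -> 0 <= E 0 ->
  (forall t : R, 0 < t -> C * t <= a0 * E (a1 / a0 * t)) ->
  forall s : R, 0 < s -> C * s <= a1 * E s.
Proof.
move=> a0p; rewrite le_eqVlt => /predU1P[<- C0 E0 Ct s s0|a1p C0 _ Ct s s0].
  suff -> : C = 0 by rewrite !mul0r.
  apply/eqP; rewrite eq_le C0 andbT leNgt; apply/negP => Cp.
  have : 0 < (a0 * E 0 + 1) / C.
    by rewrite divr_gt0// ltr_wpDl// mulr_ge0// ltW.
  move=> /Ct; rewrite !mul0r mulrC divfK ?gt_eqF//.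
  by rewrite gerDl lt_geF.
have := Ct (s * a0 / a1); rewrite divr_gt0 ?mulr_gt0// => /(_ isT).
have -> : a1 / a0 * (s * a0 / a1) = s by field; rewrite !gt_eqF.
move=> e; rewrite -(ler_pM2l (divr_gt0 a0p a1p)).
have -> : a0 / a1 * (C * s) = C * (s * a0 / a1) by ring.
by rewrite [leRHS]mulrA divfK ?gt_eqF.
Qed.

Lemma exp_step C : 0 <= C -> (forall t : R, 0 < t -> C * t <= h 0 t) ->
  expR (- 1) * C <= h 1 0.
Proof.
move=> C0 Ch; have := h_ge0 0 (lexx 0).
rewrite le_eqVlt => /predU1P[/esym h00|h00].
  apply: le_trans (slope_le_of_zero h00 Ch).
  by rewrite ler_piMl// expR_le1 lerN10.
(* The factor 1 inserted here is the value of [s] that minimises [expR s / s]. *)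
rewrite expRN mulrC ler_pdivrMr ?expR_gt0// -[C]mulr1.
apply: (@scale_bound (h 0 0)) => // [|t t0]; first exact: h_ge0.
apply: le_trans (Ch t t0) _; rewrite -[in X in _ * X](subr0 t).
by apply: log_concave_ray_tangent => //; exact: ltW.
Qed.

(* Comparing the tangent bounds of [h j] at [0] and at [u]. *)
Lemma log_derivative_le j u : 0 <= u -> h j.+1 u * h j 0 <= h j.+1 0 * h j u.
Proof.
move=> u0; have := h_ge0 j (lexx 0); rewrite le_eqVlt => /predU1P[<-|h0].
  by rewrite mulr0 mulr_ge0 ?h_ge0.
move: u0; rewrite le_eqVlt => /predU1P[<-//|u0].
have hu : 0 < h j u by apply: (lt_le_trans h0); rewrite h_ndecr// ltW.
have := log_concave_ray_tangent (h_lc j) (h_derive j 0) (lexx 0) (ltW u0) h0.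
have := log_concave_ray_tangent (h_lc j) (h_derive j u) (ltW u0) (lexx 0) hu.
set x := _ / h j 0; set y := _ / h j u; rewrite subr0 sub0r => A B.
have : h j u * 1 <= h j u * expR (- (y * u) + x * u).
  rewrite mulr1; apply: (le_trans B).
  by rewrite expRD mulrA -mulrN ler_wpM2r// expR_ge0.
rewrite ler_pM2l// -expR0 ler_expR addrC subr_ge0 ler_pM2r//.
by rewrite /x /y ler_pdivrMr// mulrAC ler_pdivlMr.
Qed.

(** The gap in [log_derivative_le] vanishes at 0 and is nonnegative to its right; its derivative at
    0 is the difference of the two sides. *)
Lemma coef_newton j : h j.+2 0 * h j 0 <= h j.+1 0 ^+ 2.
Proof.
rewrite -subr_ge0.
apply: (@right_min_derive_ge0
  (fun t => h j.+1 0 * h j t - h j.+1 t * h j 0) 0 1) => //.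
  apply: is_derive_eq; rewrite /GRing.scale/=; ring.
move=> t /andP[t0 _]; rewrite subrr subr_ge0.
by rewrite log_derivative_le// ltW.
Qed.

(** At [t = 0] only the values to the right are known, so the one-sided criterion is applied to
    [- h j]; the opposite inequality is [h_ge0]. *)
Lemma derivative_zero j : (forall t, 0 <= t -> h j t = 0) ->
  forall t, 0 <= t -> h j.+1 t = 0.
Proof.
move=> hj t t0; apply/eqP; rewrite eq_le h_ge0// andbT -oppr_ge0.
apply: (@right_min_derive_ge0 (fun s => - h j s) t (t + 1)) => //.
  by rewrite ltrDl.
by move=> s /andP[/ltW ts _]; rewrite !hj// (le_trans t0).
Qed.

(* [coef_newton] alone would leave room for internal zeros; they are excluded
   by carrying along that [h j] vanishes as soon as it does at [0]. *)
Lemma coef_ratio j : 0 < h 0 0 ->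
  h j.+1 0 <= h 1 0 / h 0 0 * h j 0 /\
  (h j 0 = 0 -> forall t, 0 <= t -> h j t = 0).
Proof.
move=> h0; set s := _ / _; elim: j => [|j [IH1 IH2]].
  by split=> [|h00]; [rewrite divfK ?gt_eqF|move: h0; rewrite h00 ltxx].
have := h_ge0 j (lexx 0); rewrite le_eqVlt => /predU1P[/esym hj|hj].
  have z := derivative_zero (IH2 hj).
  by split=> // ; rewrite (derivative_zero z)// z// mulr0.
split=> [|z t t0].
  rewrite -(ler_pM2r hj); apply: (le_trans (coef_newton j)).
  rewrite expr2 mulrAC [s * _ * _]mulrC; have := h_ge0 j.+1 (lexx 0).
  by move=> /ler_wpM2l; rewrite [_ * h j 0]mulrC; apply; rewrite mulrC.
apply/eqP; rewrite eq_le h_ge0// andbT -(ler_pM2r hj) mul0r.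
by apply: (le_trans (log_derivative_le j t0)); rewrite z mul0r.
Qed.

(** By iterating the ratio bound, the derivatives of [h 0] at 0 are dominated by those of
    [h 0 0 * expR (h 1 0 / h 0 0 * t)]. *)
Lemma coef_le_geometric j : 0 < h 0 0 ->
  h j 0 <= h 0 0 * (h 1 0 / h 0 0) ^+ j.
Proof.
move=> h0; elim: j => [|j IH]; first by rewrite expr0 mulr1.
apply: (le_trans (coef_ratio j h0).1); rewrite exprS mulrCA.
by rewrite ler_wpM2l// divr_ge0 ?h_ge0.
Qed.

End DerivativeSequence.
End Univariate.

(** * One-variable steps for polynomials and forms *)

Section UnivariateSteps.
Variable R : realType.

Lemma is_derive_taylor (c : nat -> R) k (t : R) :
  is_derive t 1 (fun t => \sum_(j < k.+1) c j * (t ^+ j / j`!%:R))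
    (\sum_(j < k) c j.+1 * (t ^+ j / j`!%:R)).
Proof.
elim: k => [|k IH].
  rewrite big_ord0 (_ : (fun _ => _) = cst (c 0%N)); first exact: is_derive_cst.
  by apply/funext => s; rewrite big_ord1 expr0 fact0 divr1 mulr1.
rewrite (_ : (fun _ => _) = (fun t => \sum_(j < k.+1) c j * (t ^+ j / j`!%:R))
    \+ (fun t => c k.+1 * (t ^+ k.+1 / k.+1`!%:R))); last first.
  by apply/funext => s; rewrite big_ord_recr.
rewrite big_ord_recr; apply: is_deriveD.
have := is_deriveX k.+1 (is_derive_id t 1); rewrite exprfctE => td.
have := is_deriveZ (c k.+1 / k.+1`!%:R) td => /is_derive_eq.
rewrite (_ : _ \*: _ = fun t => c k.+1 * (t ^+ k.+1 / k.+1`!%:R)); last first.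
  by apply/funext => s /=; rewrite /GRing.scale/= mulrAC mulrA.
apply; rewrite /GRing.scale/= factS natrM; field.
by rewrite addrC natr1 !pnatr_eq0 -lt0n fact_gt0.
Qed.

(** The two sides agree at 0, and the derivative of their difference is the same difference for the
    shifted sequence, so induction on [k] applies. *)
Lemma le_taylor (h : nat -> R -> R) k :
  (forall j (t : R), is_derive t 1 (h j) (h j.+1 t)) ->
  (forall t : R, 0 <= t -> h k.+1 t = 0) ->
  forall t : R, 0 <= t -> h 0 t <= \sum_(j < k.+1) h j 0 * (t ^+ j / j`!%:R).
Proof.
pose S (f : nat -> R -> R) m t := \sum_(j < m.+1) f j 0 * (t ^+ j / j`!%:R).
have S0 (f : nat -> R -> R) m : S f m 0 = f 0%N 0.
  rewrite /S big_ord_recl big1 ?addr0 => [|i _].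
    by rewrite expr0 fact0 divr1 mulr1.
  by rewrite exprS !mul0r mulr0.
have SD (f : nat -> R -> R) m s :
    (forall j (t : R), is_derive t 1 (f j) (f j.+1 t)) ->
    is_derive s (1 : R) (fun t => S f m t - f 0%N t)
      (\sum_(j < m) f j.+1 0 * (s ^+ j / j`!%:R) - f 1%N s).
  by move=> fd; apply: is_deriveB (is_derive_taylor (f^~ 0) m s) (fd _ _).
elim: k h => [|k IH] h hd hk t t0; rewrite -subr_ge0 -[leLHS](subrr (h 0%N 0)).
  rewrite -[X in X - _ <= _](S0 h 0%N).
  refine (ndecr_of_derive_ge0 (fun s => SD h 0%N s hd) _ (lexx 0) t0) => s s0.
  by rewrite big_ord0 hk// subr0.
rewrite -[X in X - _ <= _](S0 h k.+1).
refine (ndecr_of_derive_ge0 (fun s => SD h k.+1 s hd) _ (lexx 0) t0) => s s0.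
by rewrite subr_ge0; apply: (IH (fun j => h j.+1)).
Qed.

Lemma le_exp_trunc k (t : R) : 0 < t -> t <= exp_trunc k.+1 t.
Proof.
move=> t0; rewrite /exp_trunc !big_ord_recl/= addrCA expr1 divr1 lerDl.
rewrite addr_ge0 ?divr_ge0 ?sumr_ge0// => i _.
by rewrite divr_ge0// exprn_ge0// ltW.
Qed.

(** The infimum stays away from 0, so the inverse in [Lconst] is a genuine one. The index is [k.+1]
    because [exp_trunc 0 t / t] has infimum 0. *)
Lemma inf_exp_trunc_ge1 k :
  1 <= inf [set exp_trunc k.+1 t / t | t in [set t : R | 0 < t]].
Proof.
apply: lb_le_inf; first by exists (exp_trunc k.+1 1 / 1), 1 => //=.
by move=> _ [t /= t0 <-]; rewrite ler_pdivlMr// mul1r le_exp_trunc.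
Qed.

Lemma Lconst_ge0 k : 0 <= Lconst R k.+1.
Proof. by rewrite invr_ge0 (le_trans ler01 (inf_exp_trunc_ge1 k)). Qed.

Lemma Lconst_le1 k : Lconst R k.+1 <= 1.
Proof.
rewrite invf_le1 ?inf_exp_trunc_ge1//.
exact: lt_le_trans ltr01 (inf_exp_trunc_ge1 k).
Qed.

(** [le_taylor] and [coef_le_geometric] bound [h 0 t] by [h 0 0 * exp_trunc k.+1 (h 1 0 / h 0 0 *
    t)]; after [scale_bound] the infimum over [s] yields [Lconst]. *)
Lemma trunc_step (h : nat -> R -> R) k (C : R) :
  (forall j, log_concave_ray (h j)) ->
  (forall j (t : R), is_derive t 1 (h j) (h j.+1 t)) ->
  (forall t : R, 0 <= t -> h k.+2 t = 0) ->
  0 <= C -> (forall t : R, 0 < t -> C * t <= h 0 t) ->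
  Lconst R k.+1 * C <= h 1 0.
Proof.
move=> lc hd hk C0 Ch; have := h_ge0 lc 0 (lexx 0).
rewrite le_eqVlt => /predU1P[/esym h00|h00].
  apply: le_trans (slope_le_of_zero hd h00 Ch).
  by rewrite ler_piMl// Lconst_le1.
set m := inf [set exp_trunc k.+1 t / t | t in [set t : R | 0 < t]].
have m0 : 0 < m by exact: lt_le_trans ltr01 (inf_exp_trunc_ge1 k).
have Cs (s : R) : 0 < s -> C * s <= h 1 0 * exp_trunc k.+1 s.
  apply: (@scale_bound _ (h 0 0)) => //.
  - exact: (h_ge0 lc).
  - by apply: sumr_ge0 => i _; rewrite divr_ge0// exprn_ge0.
  move=> t t0; apply: (le_trans (Ch t t0)).
  apply: (le_trans (le_taylor hd hk (ltW t0))).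
  rewrite mulr_sumr; apply: ler_sum => j _.
  rewrite exprMn -[_ * _ / _]mulrA [leRHS]mulrA.
  rewrite ler_wpM2r ?divr_ge0 ?exprn_ge0 ?(ltW t0)//.
  exact: coef_le_geometric.
have := h_ge0 lc 1 (lexx 0); rewrite le_eqVlt => /predU1P[a1|a1].
  have := Cs 1 ltr01; rewrite -a1 mulr1 mul0r => C1.
  by rewrite mulr_ge0_le0 ?Lconst_ge0.
rewrite /Lconst -/m mulrC ler_pdivrMr// mulrC -ler_pdivrMr//.
apply: lb_le_inf; first by exists (exp_trunc k.+1 1 / 1), 1 => //=.
move=> _ [t /= t0 <-]; rewrite ler_pdivlMr// mulrAC ler_pdivrMr//.
by rewrite [leRHS]mulrC Cs.
Qed.

(* The hypothesis on [h 0] is log-concavity of a form [p] homogeneous of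
   degree [k.+1] between [y] and [w *: (y + t *: e)], where
   [h 0 t = p (y + t *: e)]. For the chosen [w] the derivative at [y]
   towards the second point vanishes, whence [w ^+ k.+1 * h 0 t <= h 0 0]. *)
Lemma homog_step (h : nat -> R -> R) k (C : R) :
  (forall j, log_concave_ray (h j)) ->
  (forall j (t : R), is_derive t 1 (h j) (h j.+1 t)) ->
  (forall w t l : R, 0 < w -> 0 < t -> 0 <= l <= 1 ->
    (w ^+ k.+1 * h 0 t) `^ l * (h 0 0) `^ (1 - l) <=
    (1 - l + l * w) ^+ k.+1 * h 0 (l * (w * t) / (1 - l + l * w))) ->
  (k = 0 -> h 0 0 = 0) ->
  0 <= C -> (forall t : R, 0 < t -> C * t <= h 0 t) ->
  (k%:R / k.+1%:R) ^+ k * C <= h 1 0.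
Proof.
move=> lc hd hom k0 C0 Ch; have := h_ge0 lc 0 (lexx 0).
rewrite le_eqVlt => /predU1P[/esym h00|h00].
  apply: le_trans (slope_le_of_zero hd h00 Ch).
  rewrite ler_piMl// exprn_ile1// ?divr_ge0//.
  by rewrite ler_pdivrMr ?ltr0n// mul1r ler_nat.
(* The optimal [s] used at the end is [k.+1%:R / k%:R], so [k = 0] must be excluded. *)
have {k0} k0 : (0 < k)%N.
  by rewrite lt0n; apply/eqP => /k0 e; move: h00; rewrite e ltxx.
have kn0 : k.+1%:R != 0 :> R by rewrite pnatr_eq0.
have a1 := h_ge0 lc 1 (lexx 0).
have Cs (s : R) : 0 < s -> C * s <= h 1 0 * (1 + s / k.+1%:R) ^+ k.+1.
  apply: (@scale_bound _ (h 0 0) _ _ (fun s => (1 + s / k.+1%:R) ^+ k.+1)) => //.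
  move=> t t0; apply: (le_trans (Ch t t0)).
  set r := h 1 0 / h 0 0 * t.
  have r0 : 0 <= r by rewrite mulr_ge0 ?divr_ge0// ltW.
  have v0 : 0 < 1 + r / k.+1%:R by rewrite ltr_pwDl// divr_ge0.
  (* The solution of [k.+1%:R * (w - 1) + r * w = 0]; the left side times [h 0 0] is the derivative
     at 0 of [f] below. *)
  pose w := (1 + r / k.+1%:R)^-1.
  have w0 : 0 < w by rewrite invr_gt0.
  pose f l := (1 - l + l * w) ^+ k.+1 * h 0 (l * (w * t) / (1 - l + l * w)).
  have f0 : f 0 = h 0 0 by rewrite /f !mul0r subr0 addr0 expr1n mul1r.
  have f1 : f 1 = w ^+ k.+1 * h 0 t.
    by rewrite /f subrr add0r !mul1r [w * t]mulrC mulfK// gt_eqF.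
  have fd : is_derive (0 : R) 1 f 0.
    have mud : is_derive (0 : R) 1 (fun l : R => 1 - l + l * w) (w - 1).
      by apply: is_derive_eq; rewrite /GRing.scale/=; ring.
    have mu0 : (fun l : R => 1 - l + l * w) 0 != 0.
      by rewrite mul0r subr0 addr0 oner_eq0.
    have mvd := @is_deriveV _ (fun l : R => 1 - l + l * w) 0 _ 1 mu0 mud.
    have arg : is_derive (0 : R) 1
        (fun l : R => l * (w * t) * (1 - l + l * w)^-1) (w * t).
      by apply: is_derive_eq; rewrite /GRing.scale/= !mul0r subr0 addr0 invr1; ring.
    have hd0 : is_derive ((fun l : R => l * (w * t) * (1 - l + l * w)^-1) 0) 1
        (h 0) (h 1 0).
      by rewrite !mul0r.
    have cd := @is_derive1_comp _ (h 0%N)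
      (fun l : R => l * (w * t) * (1 - l + l * w)^-1) 0 _ _ hd0 arg.
    have pd := is_deriveX k.+1 mud; rewrite exprfctE in pd.
    have fE : f = (fun l : R => (1 - l + l * w) ^+ k.+1) *
        (h 0%N \o (fun l : R => l * (w * t) * (1 - l + l * w)^-1)) by [].
    rewrite fE; apply: is_derive_eq.
    rewrite /GRing.scale/= !mul0r subr0 addr0 !expr1n.
    have e : w * (1 + r / k.+1%:R) = 1 by rewrite mulVf// gt_eqF.
    have -> : w - 1 = - (w * r / k.+1%:R) by rewrite -[X in _ - X = _]e; ring.
    by rewrite /r; field; rewrite addrC natr1 kn0 gt_eqF.
  have := log_concave_tangent fd.
  rewrite f0 f1 mul0r expR0 mulr1 => /(_ h00) H.
  have : w ^+ k.+1 * h 0 t <= h 0 0.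
    apply: H => [|l l01]; last exact: hom.
    by rewrite mulr_ge0 ?exprn_ge0 ?(ltW w0)// (h_ge0 lc)// ltW.
  by rewrite /w exprVn mulrC ler_pdivrMr ?exprn_gt0.
have kp : 0 < k%:R :> R by rewrite ltr0n.
(* This [s] minimises [(1 + s / k.+1%:R) ^+ k.+1 / s]; there [1 + s / k.+1%:R = s], so the minimum
   is [s ^+ k]. *)
have := Cs (k.+1%:R / k%:R); rewrite divr_gt0// => /(_ isT).
have -> : 1 + k.+1%:R / k%:R / k.+1%:R = k.+1%:R / k%:R :> R.
  by rewrite -natr1; field; rewrite natr1 kn0 gt_eqF.
rewrite exprSr mulrA ler_pM2r ?divr_gt0// => H.
by rewrite -invf_div exprVn mulrC ler_pdivrMr// exprn_gt0// divr_gt0.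
Qed.

End UnivariateSteps.

(** * Capacity and mixed derivatives *)

Section Capacity.
Variables (R : realType) (n : nat).
Implicit Types (x : 'rV[R]_n) (i : 'I_n).

(** [F (tail_ones k) (trunc_row k x)] will be the G_k(x) of the induction. *)
Definition tail_ones k : multinom n := Multinom [tuple (k <= i)%N : nat | i < n].

Definition trunc_row k x : 'rV[R]_n := \row_i (if (i < k)%N then x 0 i else 0).

Definition set_coord x i t : 'rV[R]_n := \row_j (if j == i then t else x 0 j).

Lemma tail_onesE k i : tail_ones k i = (k <= i)%N.
Proof. by rewrite mnmE. Qed.

Lemma tail_ones0 : tail_ones 0 = ones n.
Proof. by apply/mnmP => i; rewrite !mnmE. Qed.

Lemma tail_ones_max : tail_ones n = mnm0.
Proof. by apply/mnmP => i; rewrite tail_onesE mnm0E leqNgt ltn_ord. Qed.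

Lemma tail_ones_ord i :
  tail_ones i = mnm_add (tail_ones i.+1) (mnm_muln (mnm1 i) 1).
Proof.
apply/mnmP => j; rewrite mulm1n mnmDE mnm1E !tail_onesE.
by rewrite leq_eqVlt -val_eqE /=; case: ltngtP.
Qed.

Lemma mdeg_tail_ones k : (k <= n)%N -> mdeg (tail_ones k) = (n - k)%N.
Proof.
move=> kn; rewrite mdegE.
under eq_bigr do rewrite tail_onesE.
rewrite -big_mkcond/= (eq_bigl (fun i : 'I_n => (k <= i)%N))//.
have := big_geq_mkord k n xpredT (fun=> 1%N).
by move=> <-; rewrite sum_nat_const_nat muln1.
Qed.

Lemma trunc_row0 x : trunc_row 0 x = 0.
Proof. by apply/rowP => i; rewrite !mxE. Qed.

Lemma trunc_row_max x : trunc_row n x = x.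
Proof. by apply/rowP => i; rewrite !mxE ltn_ord. Qed.

Lemma trunc_row_ord i x :
  trunc_row i.+1 x = trunc_row i x + x 0 i *: 'e_i.
Proof.
apply/rowP => j; rewrite !mxE eqxx/= ltnS leq_eqVlt -val_eqE/=.
case: ltngtP => // [_|_|/val_inj ->]; rewrite ?mulr0 ?addr0//.
by rewrite mulr1 add0r.
Qed.

Lemma trunc_row_set_coord i x t :
  trunc_row i.+1 (set_coord x i t) = trunc_row i x + t *: 'e_i.
Proof.
rewrite trunc_row_ord mxE eqxx; congr (_ + _).
apply/rowP => j; rewrite !mxE; case: ltnP => // ji.
by rewrite -val_eqE ltn_eqF.
Qed.

Lemma prod_ord_recr (f : 'I_n -> R) i :
  \prod_(j < n | (j < i.+1)%N) f j = (\prod_(j < n | (j < i)%N) f j) * f i.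
Proof.
rewrite (bigD1 i) ?ltnS//= mulrC; congr (_ * _); apply: eq_bigl => j.
by rewrite ltnS ltn_neqAle andbC -val_eqE.
Qed.

Lemma prod_ord_all (f : 'I_n -> R) :
  \prod_(j < n | (j < n)%N) f j = \prod_(j < n) f j.
Proof. by apply: eq_bigl => j; rewrite ltn_ord. Qed.

(** [F c] abstracts the derivative of multi-index [c], so that one argument serves entire functions
    and polynomials alike. *)
Variable F : multinom n -> 'rV[R]_n -> R.
Hypothesis F_lc : forall c, log_concave (F c).
(* The restriction on [c] spares the symmetry of mixed partial derivatives:
   [partials] differentiates with respect to the first variables last. *)
Hypothesis F_derive : forall (c : multinom n) i,
  (forall j : 'I_n, (j < i)%N -> c j = 0%N) ->
  forall x, is_derive (0 : R) 1 (fun t => F c (x + t *: 'e_i))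
    (F (mnm_add c (mnm1 i)) x).

(** These are the successive derivatives of G_(i+1) in its last variable, in the role of [h] above;
    the first of them at 0 is G_i. *)
Definition line_seq i x j (t : R) :=
  F (mnm_add (tail_ones i.+1) (mnm_muln (mnm1 i) j)) (trunc_row i x + t *: 'e_i).

Lemma line_seq0 i x t :
  line_seq i x 0 t = F (tail_ones i.+1) (trunc_row i x + t *: 'e_i).
Proof. by rewrite /line_seq mulm0n addm0. Qed.

Lemma line_seq0_coord i x :
  line_seq i x 0 (x 0 i) = F (tail_ones i.+1) (trunc_row i.+1 x).
Proof. by rewrite line_seq0 -trunc_row_ord. Qed.

Lemma line_seq1 i x : line_seq i x 1 0 = F (tail_ones i) (trunc_row i x).
Proof. by rewrite /line_seq -tail_ones_ord scale0r addr0. Qed.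

Lemma line_ge0 i x (t : R) :
  nneg_orthant x -> 0 <= t -> nneg_orthant (trunc_row i x + t *: 'e_i).
Proof.
move=> x0 t0 j; rewrite !mxE addr_ge0 ?mulr_ge0//.
by case: ifP.
Qed.

Lemma line_seq_lc i x j : nneg_orthant x -> log_concave_ray (line_seq i x j).
Proof.
move=> x0; split=> [t t0|a b l a0 b0 l01].
  by apply: (F_lc _).1; exact: line_ge0.
have := (F_lc (mnm_add (tail_ones i.+1) (mnm_muln (mnm1 i) j))).2 _ _ l
  (line_ge0 i x0 a0) (line_ge0 i x0 b0) l01.
congr (_ <= F _ _); apply/rowP => k; rewrite !mxE; ring.
Qed.

Lemma line_seq_derive i x j (t : R) :
  is_derive t 1 (line_seq i x j) (line_seq i x j.+1 t).
Proof.
pose c := mnm_add (tail_ones i.+1) (mnm_muln (mnm1 i) j).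
have c0 (k : 'I_n) : (k < i)%N -> c k = 0%N.
  move=> ki; rewrite mnmDE tail_onesE mulmnE mnm1E leqNgt ltnS (ltnW ki).
  by rewrite -val_eqE gtn_eqF.
have d := F_derive c0 (trunc_row i x + t *: 'e_i).
(* [F_derive] gives derivatives at 0 only, hence this translation by [t]. *)
have sd : is_derive t 1 (fun s : R => s - t) 1.
  by apply: is_derive_eq; rewrite subr0.
rewrite -(subrr t) in d.
have := @is_derive1_comp _ _ (fun s : R => s - t) t _ _ d sd.
rewrite mulr1 => /is_derive_eq.
rewrite (_ : _ \o _ = line_seq i x j); last first.
  apply/funext => s; rewrite /line_seq /=; congr (F _ _).
  by rewrite -addrA -scalerDl [t + _]addrC subrK.
by apply; rewrite /line_seq mulmSr addmA.
Qed.

Lemma F_ge0 c x : nneg_orthant x -> 0 <= F c x.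
Proof. exact: (F_lc c).1. Qed.

(** Each step of the induction is the convexity bound G_k(x) x_k <= G_(k+1)(x). *)
Lemma coef_mul_prod_le k x : (k <= n)%N -> nneg_orthant x ->
  F (ones n) 0 * \prod_(j < n | (j < k)%N) x 0 j
    <= F (tail_ones k) (trunc_row k x).
Proof.
move=> kn x0; elim: k kn => [|k IH] kn.
  by rewrite big_pred0// mulr1 tail_ones0 trunc_row0.
rewrite -[k]/(nat_of_ord (Ordinal kn)) prod_ord_recr -line_seq0_coord mulrA.
apply: le_trans (linear_term_le (fun j => line_seq_lc _ j x0)
  (line_seq_derive _ x) (x0 (Ordinal kn))).
by rewrite line_seq1 ler_wpM2r// IH// ltnW.
Qed.

Lemma Cap_lb x : (forall i, 0 < x 0 i) ->
  Cap (F mnm0) * \prod_(i < n) x 0 i <= F mnm0 x.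
Proof.
move=> x0; have p0 : 0 < \prod_(i < n) x 0 i by apply: prodr_gt0.
rewrite -ler_pdivlMr//; apply: ge_inf; last by exists x.
exists 0 => _ [y /= y0 <-]; rewrite divr_ge0 ?prodr_ge0// => [|i _].
  by apply: F_ge0 => i; exact: ltW.
exact: ltW.
Qed.

Lemma Cap_nonempty (g : 'rV[R]_n -> R) :
  [set g x / (\prod_(i < n) x 0 i) |
    x in [set x : 'rV[R]_n | forall i, 0 < x 0 i]] !=set0.
Proof.
pose u : 'rV[R]_n := const_mx 1.
by exists (g u / \prod_(i < n) u 0 i), u => // i; rewrite mxE.
Qed.

Lemma Cap_ge0 : 0 <= Cap (F mnm0).
Proof.
apply: lb_le_inf; first exact: Cap_nonempty.
move=> _ [y /= y0 <-]; rewrite divr_ge0 ?prodr_ge0// => [|i _].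
  by apply: F_ge0 => i; exact: ltW.
exact: ltW.
Qed.

Lemma coef_le_Cap : F (ones n) 0 <= Cap (F mnm0).
Proof.
apply: lb_le_inf; first exact: Cap_nonempty.
move=> _ [x /= x0 <-]; rewrite ler_pdivlMr ?prodr_gt0//.
have := @coef_mul_prod_le n x (leqnn n) (fun i => ltW (x0 i)).
by rewrite trunc_row_max tail_ones_max prod_ord_all.
Qed.

(** Descending induction on k = n - m: G_k(x) is at least [Cap (F mnm0)] times the [K j] with j >= k
    and the coordinates of [x] before k. The bound must hold for all positive [x], since the next
    step varies a coordinate. *)
Lemma Cap_le_coef (K : nat -> R) :
  (forall i, 0 <= K i) ->
  (forall i x C, nneg_orthant x -> 0 <= C ->
     (forall t : R, 0 < t -> C * t <= line_seq i x 0 t) ->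
     K i * C <= line_seq i x 1 0) ->
  (\prod_(0 <= k < n) K k) * Cap (F mnm0) <= F (ones n) 0.
Proof.
move=> K0 step.
have K_ge0 k : (k < n)%N -> 0 <= K k by move=> kn; exact: (K0 (Ordinal kn)).
have prodK k : 0 <= \prod_(k <= j < n) K j.
  by rewrite big_nat; apply: prodr_ge0 => j /andP[_ /K_ge0].
have main m : (m <= n)%N -> forall x, (forall i, 0 < x 0 i) ->
    (\prod_(n - m <= j < n) K j) * Cap (F mnm0) *
      \prod_(j < n | (j < n - m)%N) x 0 j
    <= F (tail_ones (n - m)) (trunc_row (n - m) x).
  elim: m => [_ x x0|m IH mn x x0].
    rewrite subn0 big_geq// mul1r trunc_row_max tail_ones_max prod_ord_all.
    exact: Cap_lb.
  have kn : (n - m.+1 < n)%N by rewrite ltn_subrL (leq_ltn_trans _ mn).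
  have kS : (n - m.+1).+1 = (n - m)%N by rewrite -subSn.
  pose i := Ordinal kn.
  rewrite big_ltn// kS -!mulrA -[(n - m.+1)%N]/(nat_of_ord i) -line_seq1.
  apply: step; first by move=> j; exact: ltW.
    rewrite mulr_ge0// mulr_ge0 ?Cap_ge0//.
    by apply: prodr_ge0 => j _; exact: ltW.
  move=> t t0.
  (* The linear lower bound in [t] is the induction hypothesis at [x] with its coordinate [i]
     replaced by [t]. *)
  have y0 j : 0 < set_coord x i t 0 j by rewrite mxE; case: ifP.
  have := IH (ltnW mn) _ y0.
  rewrite -kS -[(n - m.+1)%N]/(nat_of_ord i) prod_ord_recr.
  rewrite trunc_row_set_coord -line_seq0 mxE eqxx !mulrA.
  congr (_ * _ * _ <= _); apply: eq_bigr => j ji.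
  by rewrite mxE -val_eqE ltn_eqF.
have u0 i : 0 < (const_mx 1 : 'rV[R]_n) 0 i by rewrite mxE.
have := main n (leqnn n) _ u0.
by rewrite subnn [X in _ * X <= _]big_pred0// mulr1 tail_ones0 trunc_row0.
Qed.

End Capacity.

(** * Polynomials *)

Section Polynomials.
Variables (R : realType) (n : nat).
Implicit Types (p q : mpoly n R) (x : 'rV[R]_n) (c : multinom n) (i : 'I_n).

(** As 0 to the power 0 is 1, this rests on the two exponents not both being 0. *)
Lemma log_concave0 : log_concave (fun _ : 'rV[R]_n => 0).
Proof.
split=> // x y l _ _ _; rewrite /powR eqxx.
by case: eqP => [->|_]; rewrite ?mul0r// subr0 oner_eq0 mulr0.
Qed.

Lemma poly_fun_derive p i x :
  is_derive (0 : R) 1 (fun t => poly_fun p (x + t *: 'e_i))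
    (poly_fun (mderiv i p) x).
Proof.
elim/mpolyind: p => [|a m p _ _ IH].
  rewrite raddf0 /poly_fun meval0 (_ : (fun _ => _) = cst 0) //.
    exact: is_derive_cst.
  by apply/funext => t; rewrite meval0.
pose A := a * \prod_(j | j != i) x 0 j ^+ m j.
have mE t : meval (fun j => (x + t *: 'e_i) 0 j) (a *: mpolyX R m)
    = A * (x 0 i + t) ^+ m i.
  rewrite mevalZ mevalX (bigD1 i)//= !mxE !eqxx mulr1 /A -mulrA; congr (_ * _).
  rewrite mulrC; congr (_ * _); apply: eq_bigr => j ji.
  by rewrite !mxE eqxx (negbTE ji) mulr0 addr0.
have dE : meval (fun j => x 0 j) (mderiv i (a *: mpolyX R m))
    = A * ((m i)%:R * x 0 i ^+ (m i).-1).
  rewrite mderivZ mderivX !mevalZ mevalX (bigD1 i)//= mnmBE mnm1E eqxx subn1.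
  rewrite /A -mulrA; congr (_ * _); rewrite mulrA mulrC; congr (_ * _).
  by apply: eq_bigr => j ji; rewrite mnmBE mnm1E eq_sym (negbTE ji) subn0.
rewrite /poly_fun raddfD/= mevalD dE.
rewrite (_ : (fun t => _) = (fun t => A * (x 0 i + t) ^+ m i)
    + (fun t => poly_fun p (x + t *: 'e_i))); last first.
  by apply/funext => t; rewrite mevalD mE.
apply: is_deriveD.
have sd : is_derive (0 : R) 1 (fun t : R => x 0 i + t) 1.
  by apply: is_derive_eq; rewrite add0r mulr1.
have pd := is_deriveX (m i) sd; rewrite exprfctE in pd.
have := is_deriveZ A pd => /is_derive_eq; apply.
by rewrite /GRing.scale/= addr0 mulr1.
Qed.

Lemma poly_fun_mderivm_derive p c i x :
  is_derive (0 : R) 1 (fun t => poly_fun (mderivm c p) (x + t *: 'e_i))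
    (poly_fun (mderivm (mnm_add c (mnm1 i)) p) x).
Proof. by rewrite mderivmDm mderivmU1m; exact: poly_fun_derive. Qed.

Lemma poly_slc_log_concave p c :
  poly_strongly_log_concave p -> log_concave (poly_fun (mderivm c p)).
Proof.
move=> /(_ c)[->|//]; rewrite (_ : poly_fun 0 = fun=> 0); last first.
  by apply/funext => x; rewrite /poly_fun meval0.
exact: log_concave0.
Qed.

Lemma mderivm_eq0 p c : (msize p <= mdeg c)%N -> mderivm c p = 0.
Proof.
move=> pc; apply/mpolyP => m; rewrite mcoeff0 mcoeff_mderivm.
rewrite [mcoeff _ p]memN_msupp_eq0 ?mul0rn//.
by apply: msize_mdeg_ge; rewrite mdegD (leq_trans pc)// leq_addr.
Qed.

Lemma mderivm_homog p c d m : p \is ishomog1 d mdeg ->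
  m \in msupp (mderivm c p) -> (mdeg m + mdeg c)%N = d.
Proof.
move=> /dhomog_mf ph; rewrite mcoeff_msupp mcoeff_mderivm => mp.
rewrite addnC -mdegD; apply: ph; rewrite mcoeff_msupp.
by apply: contra mp => /eqP ->; rewrite mul0rn.
Qed.

Lemma poly_fun_mderivm_scale p c d e a x : p \is ishomog1 d mdeg ->
  (e + mdeg c)%N = d ->
  poly_fun (mderivm c p) (a *: x) = a ^+ e * poly_fun (mderivm c p) x.
Proof.
move=> ph ed; rewrite /poly_fun !mevalE mulr_sumr big_seq [RHS]big_seq.
apply: eq_bigr => m /(mderivm_homog ph); rewrite -ed => /addIn <-.
rewrite mulrCA; congr (_ * _); rewrite mdegE -prodrXr -big_split/=.
by apply: eq_bigr => j _; rewrite mxE exprMn.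
Qed.

Variable p : mpoly n R.
Hypothesis p_slc : poly_strongly_log_concave p.

Let F c := poly_fun (mderivm c p).
Let F_lc c : log_concave (F c) := poly_slc_log_concave c p_slc.
Let F_derive c i (_ : forall j : 'I_n, (j < i)%N -> c j = 0%N) x :=
  poly_fun_mderivm_derive p c i x.

Lemma poly_fun_mderivm0 : F mnm0 = poly_fun p.
Proof. by rewrite /F mderivm0m. Qed.

Lemma poly_coef_le_Cap : poly_fun (mderivm (ones n) p) 0 <= Cap (poly_fun p).
Proof. by rewrite -poly_fun_mderivm0; exact: coef_le_Cap F_lc F_derive. Qed.

(** The factor [(m%:R / m.+1%:R) ^+ m] is the quotient of consecutive values of m! / m^m, with 0^0 =
    1 at the start. *)
Lemma prod_ratio_pow :
  \prod_(0 <= k < n) (k%:R / k.+1%:R) ^+ k = n`!%:R / n%:R ^+ n :> R.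
Proof.
elim: n => [|m IH]; first by rewrite big_geq// fact0 expr0 divr1.
rewrite big_nat_recr//= IH factS natrM exprS; case: m {IH} => [|m].
  by rewrite fact0 !expr0; field.
rewrite expr_div_n; field.
by rewrite -natrD !expf_neq0 ?pnatr_eq0.
Qed.

Lemma poly_homog_Cap_le_coef : p \is ishomog1 n mdeg ->
  n`!%:R / n%:R ^+ n * Cap (poly_fun p) <= poly_fun (mderivm (ones n) p) 0.
Proof.
move=> ph; rewrite -prod_ratio_pow -poly_fun_mderivm0.
refine (@Cap_le_coef R n F F_lc (fun k => (k%:R / k.+1%:R) ^+ k) _ _).
  by move=> i; rewrite exprn_ge0// divr_ge0.
move=> i x C x0 C0.
(* Of the degree [n], the [n - i.+1] differentiations leave [i.+1]. *)
have sc a y : F (tail_ones n i.+1) (a *: y)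
    = a ^+ i.+1 * F (tail_ones n i.+1) y.
  apply: (poly_fun_mderivm_scale _ _ ph).
  by rewrite mdeg_tail_ones ?subnKC.
apply: homog_step => //.
- by move=> j; exact: line_seq_lc.
- exact: line_seq_derive.
(* Homogeneity moves the powers into the arguments; the point on the right is then a convex
   combination of the two points on the left. *)
- move=> w t l w0 t0 l01; rewrite !line_seq0 -!sc.
  have mu0 : 0 < 1 - l + l * w.
    case/andP: l01 => l0 l1; move: l0; rewrite le_eqVlt => /predU1P[<-|l0].
      by rewrite subr0 mul0r addr0.
    by rewrite ltr_wpDl ?subr_ge0// mulr_gt0.
  have lt0 := line_ge0 i x0 (ltW t0).
  have wlt0 : nneg_orthant (w *: (trunc_row i x + t *: 'e_i)).
    by move=> j; rewrite mxE mulr_ge0 ?(ltW w0).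
  apply: le_trans ((F_lc _).2 _ _ l wlt0 (line_ge0 i x0 (lexx 0)) l01) _.
  rewrite le_eqVlt; apply/orP; left; apply/eqP; congr (F _ _).
  by apply/rowP => j; rewrite !mxE; field; rewrite gt_eqF.
(* For the first variable the point is the origin, where a form of degree 1 vanishes. *)
- move=> i0; rewrite line_seq0 scale0r addr0.
  have -> : trunc_row i x = 0 by rewrite i0 trunc_row0.
  by have := sc 0 0; rewrite scale0r expr0n mul0r.
Qed.

Lemma poly_Cap_le_coef : (msize p <= n.+1)%N ->
  (\prod_(1 <= i < n.+1) Lconst R i) * Cap (poly_fun p)
    <= poly_fun (mderivm (ones n) p) 0.
Proof.
move=> pn; rewrite big_add1/= -poly_fun_mderivm0.
refine (@Cap_le_coef R n F F_lc (fun k => Lconst R k.+1) _ _).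
  by move=> i; exact: Lconst_ge0.
move=> i x C x0 C0; apply: trunc_step => //.
- by move=> j; exact: line_seq_lc.
- exact: line_seq_derive.
(* The order of differentiation is [(n - i.+1) + i.+2 = n.+1], above the degree of [p]. *)
- move=> t t0; rewrite /line_seq /F mderivm_eq0 ?/poly_fun ?meval0//.
  rewrite mdegD mdeg_tail_ones// mdegMn mdeg1 mul1n.
  by rewrite (leq_trans pn)// addnS subnK.
Qed.

End Polynomials.

(** * Unconditional sums of complex numbers *)

Section ComplexNorm.
Variable R : realType.
Implicit Types z : R[i].

(** The norm of [R[i]] takes values in [R[i]]; estimates are made with the real-valued modulus
    instead. *)
Local Notation normc := (@Normc.normc R).

Lemma normc_ge0 z : 0 <= normc z.
Proof. by case: z => a b; exact: sqrtr_ge0. Qed.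

Lemma normc_triangle z1 z2 : normc (z1 + z2) <= normc z1 + normc z2.
Proof. by rewrite -lecR rmorphD/=; exact: (@ler_normD _ R[i]). Qed.

Lemma normc_opp z : normc (- z) = normc z.
Proof. by case: z => a b /=; rewrite !sqrrN. Qed.

Lemma normc_dist z1 z2 : normc (z1 - z2) = normc (z2 - z1).
Proof. by rewrite -normc_opp opprB. Qed.

Lemma normc_real (x : R) : normc x%:C = `|x|.
Proof. by rewrite /= expr0n addr0 sqrtr_sqr. Qed.

Lemma normcX z k : normc (z ^+ k) = normc z ^+ k.
Proof.
elim: k => [|k IH]; first by rewrite !expr0 Normc.normc1.
by rewrite !exprS Normc.normcM IH.
Qed.

Lemma normc_prod (I : Type) (r : seq I) (P : pred I) (f : I -> R[i]) :
  normc (\prod_(i <- r | P i) f i) = \prod_(i <- r | P i) normc (f i).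
Proof. by apply: big_morph => [x y|]; [exact: Normc.normcM|exact: Normc.normc1]. Qed.

Lemma normc_sum (I : Type) (r : seq I) (f : I -> R[i]) :
  normc (\sum_(i <- r) f i) <= \sum_(i <- r) normc (f i).
Proof.
elim/big_ind2: _ => [|x1 x2 y1 y2 h1 h2|//]; first by rewrite Normc.normc0.
by rewrite (le_trans (normc_triangle _ _))// lerD.
Qed.

Lemma Re_le_normc z : `|complex.Re z| <= normc z.
Proof. by case: z => a b /=; rewrite -sqrtr_sqr ler_wsqrtr// lerDl sqr_ge0. Qed.

Lemma Im_le_normc z : `|complex.Im z| <= normc z.
Proof. by case: z => a b /=; rewrite -sqrtr_sqr ler_wsqrtr// lerDr sqr_ge0. Qed.

Lemma normc_le_ReIm z : normc z <= `|complex.Re z| + `|complex.Im z|.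
Proof.
rewrite [z in normc z]complexE (le_trans (normc_triangle _ _))//.
rewrite Normc.normcM !normc_real.
by rewrite /= expr0n expr1n add0r sqrtr1 mul1r.
Qed.

Lemma Re_sum (I : Type) (r : seq I) (f : I -> R[i]) :
  complex.Re (\sum_(i <- r) f i) = \sum_(i <- r) complex.Re (f i).
Proof. by apply: big_morph => // -[a b] [c d]. Qed.

Lemma Im_sum (I : Type) (r : seq I) (f : I -> R[i]) :
  complex.Im (\sum_(i <- r) f i) = \sum_(i <- r) complex.Im (f i).
Proof. by apply: big_morph => // -[a b] [c d]. Qed.

End ComplexNorm.

Section UnconditionalSums.
Variables (R : realType) (I : choiceType).
Implicit Types (u v : I -> R[i]) (s t : R[i]) (A B : {fset I}).

Local Notation normc := (@Normc.normc R).

#[local] Existing Instance totally_filter.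

Definition has_sum u s := forall e : R, 0 < e -> exists A, forall B,
  (A `<=` B)%fset -> normc (s - \sum_(i <- B) u i) < e.

Lemma has_sumP (u : I -> R[i]^o) (s : R[i]^o) :
  partial_sum u @ totally --> s <-> has_sum u s.
Proof.
have pE B : partial_sum u B = \sum_(i <- B) u i by rewrite big_seq_fsetE.
split=> [/cvgrPdist_lt H e e0|H].
  have [|A _ AB] := H e%:C; first by rewrite ltcR.
  by exists A => B /AB; rewrite /= pE -ltcR.
apply/cvgrPdist_lt => e e0.
have er : e = (complex.Re e)%:C by rewrite RRe_real// gtr0_real.
have [|A AB] := H (complex.Re e); first by rewrite -ltcR -er.
by exists A => // B /AB; rewrite /= pE -ltcR -er.
Qed.

Lemma has_sumB u v s t :
  has_sum u s -> has_sum v t -> has_sum (fun i => u i - v i) (s - t).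
Proof.
move=> us vt e e0; have e2 : 0 < e / 2 by rewrite divr_gt0.
have [A uA] := us _ e2; have [A' vA'] := vt _ e2.
exists (A `|` A')%fset => B; rewrite fsubUset => /andP[/uA uB /vA' vB].
rewrite sumrB (_ : _ - _ = (s - \sum_(i <- B) u i)
  - (t - \sum_(i <- B) v i)); last by ring.
rewrite (le_lt_trans (normc_triangle _ _))// normc_opp; lra.
Qed.

Lemma has_sumZ (k : R[i]) u s :
  has_sum u s -> has_sum (fun i => k * u i) (k * s).
Proof.
move=> us e e0.
have k0 : 0 < normc k + 1 by rewrite ltr_wpDl// normc_ge0.
have [A uA] := us (e / (normc k + 1)) (divr_gt0 e0 k0).
exists A => B /uA; rewrite ltr_pdivlMr// -mulr_sumr -mulrBr Normc.normcM.
by apply: le_lt_trans; rewrite mulrC ler_wpM2l ?normc_ge0// lerDl.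
Qed.

Lemma has_sum_norm_le u s (M : R) :
  has_sum u s -> (forall B, normc (\sum_(i <- B) u i) <= M) -> normc s <= M.
Proof.
move=> us uM; apply/ler_addgt0Pl => e e0; have [A uA] := us e e0.
have := uA A (fsubset_refl A) => sA.
rewrite -(subrK (\sum_(i <- A) u i) s) (le_trans (normc_triangle _ _))//.
by rewrite lerD// ltW.
Qed.

Lemma sum_fsetU_disjoint u A B : [disjoint A & B]%fset ->
  \sum_(i <- (A `|` B)%fset) u i = \sum_(i <- A) u i + \sum_(i <- B) u i.
Proof.
move=> AB; rewrite (big_fsetID _ (mem A))/=; congr (_ + _).
  apply: eq_fbigl => i; rewrite !inE.
  by case: (i \in A) => //=; rewrite ?andbF.
apply: eq_fbigl => i; rewrite !inE; have /fdisjointP/(_ i) := AB.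
by case: (i \in A) => [/(_ isT)/negbTE->|_]; rewrite ?andbF ?andbT.
Qed.

(* Finite sums disjoint from a Cauchy set are bounded; split them by the signs
   of the real and imaginary parts. *)
Lemma has_sum_bounded u s : has_sum u s ->
  exists K : R, forall B, \sum_(i <- B) normc (u i) <= K.
Proof.
move=> us; have [A uA] := us 1 ltr01.
have small D : [disjoint A & D]%fset -> normc (\sum_(i <- D) u i) <= 2.
  move=> AD; have sA := uA A (fsubset_refl A).
  have sAD := uA _ (fsubsetUl A D); rewrite sum_fsetU_disjoint// in sAD.
  rewrite (_ : \sum_(i <- D) u i = (s - \sum_(i <- A) u i)
    - (s - (\sum_(i <- A) u i + \sum_(i <- D) u i))); last by ring.
  by rewrite (le_trans (normc_triangle _ _))// normc_opp; lra.
(* With [g] the real or the imaginary part, the terms of each sign contribute at most 2. *)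
have half (g : R[i] -> R) D : [disjoint A & D]%fset ->
    (forall B (f : I -> R[i]), g (\sum_(i <- B) f i) = \sum_(i <- B) g (f i)) ->
    (forall z, `|g z| <= normc z) -> \sum_(i <- D) `|g (u i)| <= 4.
  move=> AD gsum gle; rewrite (big_fsetID _ (fun i => 0 <= g (u i)))/=.
  have sub (P : pred I) : `|\sum_(i <- [fset x in D | P x]%fset) g (u i)| <= 2.
    rewrite -gsum (le_trans (gle _))// small//.
    by apply/fdisjointP => i iA; rewrite !inE negb_and (fdisjointP AD).
  have -> : \sum_(i <- [fset x in D | 0 <= g (u x)]%fset) `|g (u i)| =
      \sum_(i <- [fset x in D | 0 <= g (u x)]%fset) g (u i).
    rewrite big_seq [RHS]big_seq; apply: eq_bigr => i.
    by rewrite !inE => /andP[_ /ger0_norm].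
  have -> : \sum_(i <- [fset x in D | ~~ (0 <= g (u x))]%fset) `|g (u i)| =
      - \sum_(i <- [fset x in D | ~~ (0 <= g (u x))]%fset) g (u i).
    rewrite -sumrN big_seq [RHS]big_seq; apply: eq_bigr => i.
    by rewrite !inE -ltNge => /andP[_ /ltr0_norm].
  have := sub (fun x => 0 <= g (u x)); have := sub (fun x => ~~ (0 <= g (u x))).
  rewrite !ler_norml => /andP[a1 a2] /andP[b1 b2]; lra.
exists (\sum_(i <- A) normc (u i) + 8) => B.
have dA : [disjoint A & B `\` A]%fset.
  by apply/fdisjointP => i iA; rewrite !inE iA.
rewrite (big_fsetID _ (mem A))/= lerD//.
  rewrite [leRHS](big_fsetID _ (mem B))/= -[leLHS]addr0 lerD ?sumr_ge0//.
    rewrite le_eqVlt; apply/orP; left; apply/eqP.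
    by apply: eq_fbigl => i; rewrite !inE andbC.
  by move=> i _; exact: normc_ge0.
have -> : \sum_(i <- [fset x in B | x \notin A]%fset) normc (u i) =
    \sum_(i <- (B `\` A)%fset) normc (u i).
  by apply: eq_fbigl => i; rewrite !inE andbC.
have hR := half (@complex.Re R) _ dA (fun _ _ => Re_sum _ _) (@Re_le_normc R).
have hI := half (@complex.Im R) _ dA (fun _ _ => Im_sum _ _) (@Im_le_normc R).
apply: le_trans (_ : \sum_(i <- (B `\` A)%fset)
  (`|complex.Re (u i)| + `|complex.Im (u i)|) <= _).
  by apply: ler_sum => i _; exact: normc_le_ReIm.
rewrite big_split/=; lra.
Qed.

(** A finite set nearly attaining the supremum of the sums of moduli leaves only small tails, so the
    partial sums are Cauchy. Completeness is that of [R], applied to real and imaginary parts. *)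
Lemma bounded_has_sum u (K : R) :
  (forall B, \sum_(i <- B) normc (u i) <= K) -> exists s, has_sum u s.
Proof.
move=> uK.
pose E := [set \sum_(i <- B) normc (u i) | B in [set: {fset I}]].
have supE : has_sup E.
  split; first by exists (\sum_(i <- fset0) normc (u i)), fset0.
  by exists K => _ [B _ <-].
have tail e : 0 < e -> exists A, forall B, (A `<=` B)%fset ->
    normc (\sum_(i <- B) u i - \sum_(i <- A) u i) < e.
  move=> e0; have [_ [A _ <-] Ae] := sup_adherent e0 supE.
  exists A => B AB.
  have BE : B = (A `|` (B `\` A))%fset.
    by apply/fsetP => i; rewrite !inE; case: (boolP (i \in A)) => //= /(fsubsetP AB).
  rewrite {1}BE sum_fsetU_disjoint; last first.
    by apply/fdisjointP => i iA; rewrite !inE iA.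
  rewrite addrC addKr (le_lt_trans (normc_sum _ _))//.
  have : \sum_(i <- B) normc (u i) <= sup E.
    by apply: sup_upper_bound => //; exists B.
  rewrite (big_fsetID _ (mem A))/=.
  have -> : \sum_(i <- [fset x in B | x \in A]%fset) normc (u i) =
      \sum_(i <- A) normc (u i).
    apply: eq_fbigl => i; rewrite !inE andbC; case: (boolP (i \in A)) => //=.
    by move=> /(fsubsetP AB).
  have -> : \sum_(i <- [fset x in B | x \notin A]%fset) normc (u i) =
      \sum_(i <- (B `\` A)%fset) normc (u i).
    by apply: eq_fbigl => i; rewrite !inE andbC.
  lra.
have lim (g : R[i] -> R) : (forall z w, g (z - w) = g z - g w) ->
    (forall z, `|g z| <= normc z) ->
    exists l, forall e, 0 < e -> exists A, forall B, (A `<=` B)%fset ->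
      `|l - g (\sum_(i <- B) u i)| < e.
  move=> gB gle.
  have /cauchy_cvg/cvg_ex[l /cvgrPdist_lt gl] :
      cauchy ((fun B => g (\sum_(i <- B) u i)) @ totally).
    apply: cauchy_exP => e e0; have [A Ae] := tail e e0.
    exists (g (\sum_(i <- A) u i)); exists A => // B /Ae AB.
    by rewrite /= /ball/= distrC -gB (le_lt_trans (gle _)).
  by exists l => e /gl[A _ AB]; exists A.
have ReB (z w : R[i]) : complex.Re (z - w) = complex.Re z - complex.Re w.
  by case: z w => ? ? [].
have ImB (z w : R[i]) : complex.Im (z - w) = complex.Im z - complex.Im w.
  by case: z w => ? ? [].
have [a ua] := lim _ ReB (@Re_le_normc R).
have [b ub] := lim _ ImB (@Im_le_normc R).
exists (a +i* b) => e e0; have e2 : 0 < e / 2 by rewrite divr_gt0.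
have [A uA] := ua _ e2; have [A' uA'] := ub _ e2.
exists (A `|` A')%fset => B; rewrite fsubUset => /andP[/uA uB /uA' vB].
rewrite (le_lt_trans (normc_le_ReIm _))// ReB ImB/=; lra.
Qed.

End UnconditionalSums.

(** [u] vanishes off the range of [f], so a sum over [B] can be enlarged to one over a set
    containing [A]. This serves to shift the exponents of a differentiated series. *)
Lemma has_sum_reindex (R : realType) (I J : choiceType) (u : I -> R[i]) s
    (f : J -> I) (g : I -> J) :
  cancel f g -> (forall i, f (g i) != i -> u i = 0) -> has_sum u s ->
  has_sum (u \o f) s.
Proof.
move=> fK u0 us e e0; have [A uA] := us e e0.
exists [fset g i | i in A]%fset => B AB.
pose fB := [fset f j | j in B]%fset.
rewrite (_ : \sum_(j <- B) (u \o f) j = \sum_(i <- (A `|` fB)%fset) u i).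
  by apply: uA; exact: fsubsetUl.
have <- : \sum_(i <- fB) u i = \sum_(j <- B) u (f j).
  by rewrite /fB big_imfset//= => x y _ _; exact: (can_inj fK).
apply: big_fset_incl; first exact: fsubsetUr.
move=> i; rewrite inE => /orP[iA|->//] niB; apply: u0.
apply: contra niB => /eqP <-; apply/imfsetP; exists (g i) => //=.
by apply: (fsubsetP AB); apply/imfsetP; exists i.
Qed.

(** * Entire functions *)

Section PowerSeries.
Variables (R : realType) (n : nat).
Implicit Types (c : multinom n) (i j : 'I_n) (z : 'rV[R[i]]_n) (s : R).

Local Notation normc := (@Normc.normc R).

Lemma normc_nat m : normc m%:R = m%:R.
Proof. by rewrite -(rmorph_nat (real_complex R)) normc_real ger0_norm. Qed.

Lemma natr_le_exp4 m : m%:R <= 4 ^+ m :> R.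
Proof. by rewrite -natrX ler_nat ltnW// ltn_expl. Qed.

(** In the induction, multiplying the old remainder by [u + h] costs [2 * s], and the new term costs
    [s] since m <= 4^m; both fit into the extra factor [4 * s]. *)
Lemma pow_remainder (u h : R[i]) s m : normc u <= s -> normc h <= s ->
  normc ((u + h) ^+ m - u ^+ m - m%:R * h * u ^+ m.-1) * s ^+ 2
    <= normc h ^+ 2 * (4 * s) ^+ m.
Proof.
move=> us hs; have s0 : 0 <= s by rewrite (le_trans _ us)// normc_ge0.
elim: m => [|m IH].
  by rewrite !expr0 subrr mul0r mul0r subrr Normc.normc0 mul0r mulr1 sqr_ge0.
have -> : (u + h) ^+ m.+1 - u ^+ m.+1 - m.+1%:R * h * u ^+ m.+1.-1 =
    (u + h) * ((u + h) ^+ m - u ^+ m - m%:R * h * u ^+ m.-1) +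
    m%:R * h ^+ 2 * u ^+ m.-1.
  case: m {IH} => [|m]; first by rewrite !expr0 !expr1 /=; ring.
  by rewrite /= !exprS -natr1; ring.
set E := _ - _ - _ in IH *.
have E0 := normc_ge0 E; have h0 := normc_ge0 h.
have le1 : normc ((u + h) * E) * s ^+ 2 <= 2 * s * (normc h ^+ 2 * (4 * s) ^+ m).
  rewrite Normc.normcM -mulrA ler_pM ?normc_ge0 ?mulr_ge0 ?sqr_ge0//.
  by rewrite (le_trans (normc_triangle _ _))//; lra.
have le2 : normc (m%:R * h ^+ 2 * u ^+ m.-1) * s ^+ 2
    <= normc h ^+ 2 * (s * (4 * s) ^+ m).
  rewrite !Normc.normcM !normcX normc_nat.
  case: m {IH E E0 le1} => [|m]; first by rewrite !mul0r mulr_ge0 ?mulr_ge0 ?sqr_ge0.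
  have -> : m.+1%:R * normc h ^+ 2 * normc u ^+ m.+1.-1 * s ^+ 2 =
    normc h ^+ 2 * (s * (m.+1%:R * (normc u ^+ m * s))) by rewrite /=; ring.
  rewrite ler_wpM2l ?sqr_ge0// ler_wpM2l// exprMn ler_pM ?natr_le_exp4//.
    by rewrite mulr_ge0// exprn_ge0// normc_ge0.
  by rewrite exprSr ler_wpM2r// lerXn2r ?nnegrE ?normc_ge0.
apply: le_trans (_ : normc ((u + h) * E) * s ^+ 2 +
  normc (m%:R * h ^+ 2 * u ^+ m.-1) * s ^+ 2 <= _).
  by rewrite -mulrDl ler_wpM2r ?sqr_ge0// normc_triangle.
apply: (le_trans (lerD le1 le2)); rewrite [(4 * s) ^+ m.+1]exprS.
set P := (4 * s) ^+ m; have P0 : 0 <= s * (normc h ^+ 2 * P).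
  by rewrite !mulr_ge0 ?sqr_ge0// exprn_ge0// mulr_ge0.
by rewrite -subr_ge0 (_ : _ - _ = s * (normc h ^+ 2 * P))//; ring.
Qed.

Lemma pow_derivative_bound (u : R[i]) s m : normc u <= s ->
  m%:R * normc u ^+ m.-1 * s <= (4 * s) ^+ m.
Proof.
move=> us; have s0 : 0 <= s by rewrite (le_trans _ us)// normc_ge0.
case: m => [|m]; first by rewrite !mul0r expr0.
rewrite exprMn -mulrA ler_pM ?natr_le_exp4//.
  by rewrite mulr_ge0// exprn_ge0// normc_ge0.
by rewrite exprSr ler_wpM2r// lerXn2r ?nnegrE ?normc_ge0.
Qed.

Definition other_factors c i z : R[i] := \prod_(j < n | j != i) z 0 j ^+ c j.

Lemma monomialE c i z : monomial c z = z 0 i ^+ c i * other_factors c i z.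
Proof. by rewrite /monomial (bigD1 i). Qed.

Lemma normc_other_factors c i z s : (forall j, normc (z 0 j) <= s) ->
  normc (other_factors c i z) * (4 * s) ^+ c i <= (4 * s) ^+ mdeg c.
Proof.
move=> zs; have s0 : 0 <= s by rewrite (le_trans _ (zs i))// normc_ge0.
rewrite mdegE -prodrXr (bigD1 i)//= mulrC ler_wpM2l ?exprn_ge0 ?mulr_ge0//.
rewrite normc_prod; apply: ler_prod => j _; rewrite normcX exprn_ge0 ?normc_ge0//=.
rewrite lerXn2r ?nnegrE ?normc_ge0 ?mulr_ge0// (le_trans (zs j))//; lra.
Qed.

(** The termwise derivative in the variable [i]; when [c i = 0] the truncated exponent is harmless,
    as the factor [(c i)%:R] is 0. *)
Definition dterm (a : multinom n -> R[i]) i z c : R[i] :=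
  a c * ((c i)%:R * z 0 i ^+ (c i).-1 * other_factors c i z).

Section Estimates.
Variables (a : multinom n -> R[i]) (s K : R).
Hypothesis s_gt0 : 0 < s.
(** Absolute convergence at radius [4 * s] controls derivatives and second-order remainders at
    radius [s]. *)
Hypothesis aK : forall B : {fset multinom n},
  \sum_(c <- B) normc (a c) * (4 * s) ^+ mdeg c <= K.

Lemma dterm_bound i z (B : {fset multinom n}) : (forall j, normc (z 0 j) <= s) ->
  \sum_(c <- B) normc (dterm a i z c) <= K / s.
Proof.
move=> zs; rewrite ler_pdivlMr// mulr_suml; apply: le_trans (aK B).
apply: ler_sum => c _; rewrite !Normc.normcM normcX normc_nat -!mulrA.
rewrite ler_wpM2l ?normc_ge0//.
apply: le_trans (normc_other_factors c i zs).
rewrite [leLHS](_ : _ = normc (other_factors c i z) *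
  ((c i)%:R * normc (z 0 i) ^+ (c i).-1 * s)); last by ring.
by rewrite ler_wpM2l ?normc_ge0// pow_derivative_bound.
Qed.

Lemma increment_bound i z (h : R[i]) (B : {fset multinom n}) :
  (forall j, normc (z 0 j) <= s) -> normc h <= s ->
  normc (\sum_(c <- B) (a c * monomial c (z + h *: 'e_i) - a c * monomial c z
    - h * dterm a i z c)) <= normc h ^+ 2 * (K / s ^+ 2).
Proof.
move=> zs hs; rewrite mulrA ler_pdivlMr ?exprn_gt0//.
apply: le_trans (_ : (\sum_(c <- B) normc (a c * monomial c (z + h *: 'e_i)
    - a c * monomial c z - h * dterm a i z c)) * s ^+ 2 <= _).
  by rewrite ler_wpM2r ?sqr_ge0// normc_sum.
rewrite mulr_suml; apply: le_trans (_ : normc h ^+ 2 *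
    (\sum_(c <- B) normc (a c) * (4 * s) ^+ mdeg c) <= _); last first.
  by rewrite ler_wpM2l ?sqr_ge0.
rewrite mulr_sumr; apply: ler_sum => c _.
have -> : a c * monomial c (z + h *: 'e_i) - a c * monomial c z
    - h * dterm a i z c = a c * (other_factors c i z *
    ((z 0 i + h) ^+ c i - z 0 i ^+ c i - (c i)%:R * h * z 0 i ^+ (c i).-1)).
  rewrite !(monomialE _ i) /dterm.
  have -> : other_factors c i (z + h *: 'e_i) = other_factors c i z.
    apply: eq_bigr => j ji; rewrite !mxE (negbTE ji) andbF.
    by rewrite mulr0 addr0.
  by rewrite !mxE !eqxx /= mulr1; ring.
set E := (z 0 i + h) ^+ c i - _ - _.
rewrite !Normc.normcM [leRHS]mulrCA -!mulrA ler_wpM2l ?normc_ge0//.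
apply: le_trans (_ : normc (other_factors c i z) *
  (normc h ^+ 2 * (4 * s) ^+ c i) <= _).
  by rewrite ler_wpM2l ?normc_ge0//; exact: pow_remainder.
by rewrite [leRHS]mulrA -expr2 [leLHS]mulrCA ler_wpM2l ?sqr_ge0// normc_other_factors.
Qed.

End Estimates.
End PowerSeries.

Lemma is_derive_of_cvg (K : numFieldType) (V W : normedModType K) (f : V -> W)
    (a v : V) (l : W) :
  (fun h : K => h^-1 *: ((f \o shift a) (h *: v) - f a)) @ 0^' --> l ->
  is_derive a v f l.
Proof.
by move=> fl; apply: DeriveDef; [apply/cvg_ex; exists l|exact: cvg_lim].
Qed.

(** * Partial derivatives of entire functions *)

Section EntireFunctions.
Variables (R : realType) (n : nat).
Implicit Types (f g : 'rV[R[i]]_n -> R[i]^o) (c : multinom n) (i j : 'I_n).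
Implicit Types (z w : 'rV[R[i]]_n).

Local Notation normc := (@Normc.normc R).

Lemma is_derive_of_quadratic f z v (T : R[i]) (s K : R) : 0 < s -> 0 <= K ->
  (forall h : R[i], normc h < s ->
     normc (f (z + h *: v) - f z - h * T) <= normc h ^+ 2 * K) ->
  is_derive z v f T.
Proof.
move=> s0 K0 fT.
apply: is_derive_of_cvg; apply/cvgrPdist_lt => e e0.
have er : e = (complex.Re e)%:C by rewrite RRe_real// gtr0_real.
have {e0}e0 : 0 < complex.Re e by rewrite -ltcR -er.
have K1 : 0 < K + 1 by rewrite ltr_wpDl.
(* [K + 1] rather than [K], which may be 0. *)
pose d := Num.min s (complex.Re e / (K + 1)).
have d0 : 0 < d by rewrite lt_min s0 divr_gt0.
exists d%:C => /=; first by rewrite ltcR.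
move=> h; rewrite /= sub0r normrN => hd hn0.
have {hd} : normc h < d by rewrite -ltcR.
rewrite lt_min => /andP[hs he].
have h0 : 0 < normc h.
  by rewrite lt_neqAle normc_ge0 andbT eq_sym; apply: contra hn0 => /eqP/Normc.eq0_normc ->.
rewrite er -[ `|_| ]/((normc _)%:C) ltcR.
rewrite -(ltr_pM2l h0) -Normc.normcM mulrBr [X in _ - X]mulVKf//.
rewrite normc_dist [h *: v + z]addrC.
apply: (le_lt_trans (fT h hs)).
rewrite expr2 -mulrA ltr_pM2l//.
move: he; rewrite ltr_pdivlMr//; apply: le_lt_trans.
by rewrite ler_wpM2l ?normc_ge0// lerDl.
Qed.

(** Termwise differentiation on a smaller polydisc; it gives both the existence of the partial
    derivative and its holomorphy. *)
Lemma holomorphic_derive f w i : holomorphic_at f w ->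
  exists2 s : R, 0 < s & exists b : multinom n -> R[i]^o,
    forall z, (forall j, `|z 0 j - w 0 j| < s%:C) ->
      exists2 T : R[i]^o, is_derive z 'e_i f T &
        has_sum (fun c => b c * monomial c (z - w)) T.
Proof.
move=> [r r0 [a fa]].
(* Then [4 * s < r], so the series converges at the point of offset [4 * s] in every coordinate, and
   absolutely by [has_sum_bounded]. *)
pose s := r / 8; have s0 : 0 < s by rewrite divr_gt0.
have {}fa z : (forall j, normc (z 0 j - w 0 j) < r) ->
    has_sum (fun c => a c * monomial c (z - w)) (f z).
  by move=> zr; apply/has_sumP/fa => j; rewrite -[ `|_| ]/((normc _)%:C) ltcR.
have [K aK] : exists K : R, forall B : {fset multinom n},
    \sum_(c <- B) normc (a c) * (4 * s) ^+ mdeg c <= K.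
  pose z := w + const_mx (4 * s)%:C.
  have /has_sum_bounded[K uK] : has_sum (fun c => a c * monomial c (z - w)) (f z).
    apply: fa => j; rewrite !mxE [w 0 j + _]addrC addrK normc_real ger0_norm; last first.
      by rewrite mulr_ge0// ltW.
    by rewrite /s; lra.
  exists K => B; apply: le_trans (uK B); rewrite le_eqVlt; apply/orP; left.
  apply/eqP/eq_bigr => c _; rewrite Normc.normcM normc_prod; congr (_ * _).
  rewrite mdegE -prodrXr; apply: eq_bigr => j _.
  rewrite !mxE [w 0 j + _]addrC addrK normcX normc_real ger0_norm//.
  by rewrite mulr_ge0// ltW.
have K0 : 0 <= K by have := aK fset0; rewrite big_seq_fset0.
exists s => //; exists (fun c => (c i).+1%:R * a (mnm_add c (mnm1 i))) => z zw.
pose y := z - w.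
have ys j : normc (y 0 j) < s by have := zw j; rewrite !mxE -ltcR.
have ys' j : normc (y 0 j) <= s := ltW (ys j).
have [T uT] := bounded_has_sum (fun B => dterm_bound s0 aK i B ys').
exists T.
  apply: (is_derive_of_quadratic (s := s) (K := K / s ^+ 2)) => //.
    by rewrite divr_ge0// sqr_ge0.
  move=> h hs.
  have fz : has_sum (fun c => a c * monomial c y) (f z).
    by apply: fa => j; have := ys j; rewrite !mxE /s; lra.
  have fzh : has_sum (fun c => a c * monomial c (y + h *: 'e_i)) (f (z + h *: 'e_i)).
    rewrite /y addrAC; apply: fa => j; rewrite !mxE addrAC.
    rewrite (le_lt_trans (normc_triangle _ _))//.
    have := ys j; rewrite !mxE => yj.
    have : normc (h * ((0 == 0 :> 'I_1) && (j == i))%:R) <= normc h.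
      rewrite Normc.normcM normc_nat ler_piMr ?normc_ge0//.
      by rewrite lern1 leq_b1.
    by move: hs yj; rewrite /s => hs yj le; lra.
  (* The bound is uniform over finite sets, hence passes to the sum. *)
  apply: (has_sum_norm_le (has_sumB (has_sumB fzh fz) (has_sumZ h uT))) => B.
  exact: increment_bound (ltW hs).
have := @has_sum_reindex R _ _ _ T (fun c => mnm_add c (mnm1 i))
  (fun c => mnm_sub c (mnm1 i)) _ _ uT.
rewrite (_ : _ \o _ = fun c => (c i).+1%:R * a (mnm_add c (mnm1 i)) * monomial c y).
  apply; first exact: addmK.
  (* The multi-indices missed by the shift have [c i = 0], and their terms vanish. *)
  move=> c; case: (eqVneq (c i) 0%N) => [ci _|ci].
    by rewrite /dterm ci !mul0r mulr0.
  by rewrite submK ?eqxx// lep1mP.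
apply/funext => c; rewrite /dterm /= mnmDE mnm1E eqxx addn1 /= (monomialE c i).
rewrite (_ : other_factors (mnm_add c (mnm1 i)) i y = other_factors c i y).
  by ring.
by apply: eq_bigr => j ji; rewrite mnmDE mnm1E eq_sym (negbTE ji) addn0.
Qed.

Lemma entire_derivable f z i : entire f -> derivable f z 'e_i.
Proof.
move=> /(_ z)/(holomorphic_derive i)[s s0 [b]] /(_ z)[|T dT _]; last exact: ex_derive.
by move=> j; rewrite subrr normr0 ltcR.
Qed.

Lemma entire_partial f i : entire f -> entire (partial i f).
Proof.
move=> ef w; have [s s0 [b bT]] := holomorphic_derive i (ef w).
exists s => //; exists b => z zw; have [T dT uT] := bT z zw.
by rewrite /partial (derive_val (is_derive := dT)); apply/has_sumP.
Qed.

Lemma entire_partials f c : entire f -> entire (partials c f).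
Proof.
move=> ef; rewrite /partials; elim: (enum 'I_n) => [|i s IH]; first exact: ef.
change (entire (iter (c i) (partial i)
  (foldr (fun i g => iter (c i) (partial i) g) f s))).
by elim: (c i) => [|k IHk]; [exact: IH|exact: (@entire_partial _ i IHk)].
Qed.

Lemma partials0 f : partials mnm0 f = f.
Proof. by rewrite /partials; elim: (enum 'I_n) => //= i s ->; rewrite mnm0E. Qed.

(** The fold applies the smallest index last. As [c] vanishes before [i], the operators there are
    identities, and the added derivative is outermost. *)
Lemma partials_addU f c i : (forall j, (j < i)%N -> c j = 0%N) ->
  partials (mnm_add c (mnm1 i)) f = partial i (partials c f).
Proof.
move=> c0; rewrite /partials.
have : i \in enum 'I_n by rewrite mem_enum.
have : sorted ltn (map val (enum 'I_n)) by rewrite val_enum_ord iota_ltn_sorted.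
elim: (enum 'I_n) => //= k s IH; rewrite (path_sortedE ltn_trans) => /andP[ks ss].
rewrite inE => /predU1P[ik|is_].
  rewrite -{}ik in ks *; rewrite mnmDE mnm1E eqxx addn1 /=; congr (partial i _).
  congr (iter _ _ _).
  have : i \notin s.
    apply/negP => is_; have /allP/(_ (val i)) := ks.
    by rewrite map_f//= ltnn => /(_ isT).
  elim: s {IH ks ss} => //= l s IH; rewrite inE negb_or => /andP[il is_].
  by rewrite IH// mnmDE mnm1E (negbTE il) addn0.
have ki : (k < i)%N by have /allP := ks; apply; exact: map_f.
by rewrite mnmDE mnm1E -val_eqE gtn_eqF//= c0//= IH.
Qed.

(** The complex difference quotient is restricted to real increments; [complex.Re] is real-linear
    and bounded by the modulus. *)
Lemma real_restriction_derive g i (x : 'rV[R]_n) :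
  derivable g (map_mx (real_complex R) x) 'e_i ->
  is_derive (0 : R) 1 (fun t => real_restriction g (x + t *: 'e_i))
    (real_restriction (partial i g) x).
Proof.
move=> dg; set z := map_mx _ x in dg *.
have := dg; rewrite /derivable => /cvgrPdist_lt.
rewrite -[lim _]/('D_('e_i) g z) => gz.
set d := real_restriction _ _.
apply: is_derive_of_cvg; apply/cvgrPdist_lt => e e0.
have [|r /= r0 rB] := gz e%:C; first by rewrite ltcR.
have rr : r = (complex.Re r)%:C by rewrite RRe_real// gtr0_real.
exists (complex.Re r) => /=; first by rewrite -ltcR -rr.
move=> h; rewrite /= sub0r normrN => hr hn0.
have /rB : ball_ (fun x : R[i] => `|x|) 0 r h%:C.
  by rewrite /= sub0r normrN rr -[ `|_| ]/((normc _)%:C) normc_real ltcR.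
have -> : h%:C != 0 by apply: contra hn0 => /eqP[->].
move=> /(_ isT); rewrite -[ `|_| ]/((normc _)%:C) ltcR; apply: le_lt_trans.
apply: le_trans (Re_le_normc _).
rewrite le_eqVlt; apply/orP; left; apply/eqP; congr `|_|.
rewrite /d /real_restriction scale0r !addr0 -/z.
have -> : map_mx (real_complex R) (x + h%:A *: 'e_i) = h%:C *: 'e_i + z.
  apply/rowP => j; rewrite !mxE rmorphD rmorphM/= [h%:A]mulr1 addrC.
  by rewrite rmorph_nat.
rewrite -[partial i g z]/('D_('e_i) g z).
case: ('D_('e_i) g z) => a b; case: (g _) => a1 b1; case: (g z) => a2 b2.
by rewrite -fmorphV /GRing.scale/= mul0r subr0.
Qed.

(** * Capacity bounds for entire functions *)

Section StronglyLogConcave.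
Variable f : 'rV[R[i]]_n -> R[i]^o.
Hypothesis f_entire : entire f.
Hypothesis f_slc : strongly_log_concave f.

Let F c := real_restriction (partials c f).

Lemma slc_log_concave c : log_concave (F c).
Proof.
case: (f_slc c) => // f0; rewrite /F (_ : real_restriction _ = fun=> 0).
  exact: log_concave0.
by apply/funext => x; rewrite /real_restriction f0.
Qed.

Lemma slc_derive c i : (forall j : 'I_n, (j < i)%N -> c j = 0%N) ->
  forall x, is_derive (0 : R) 1 (fun t => F c (x + t *: 'e_i))
    (F (mnm_add c (mnm1 i)) x).
Proof.
move=> c0 x; rewrite /F partials_addU//; apply: real_restriction_derive.
exact/entire_derivable/entire_partials.
Qed.

Lemma real_restriction0 g : real_restriction g 0 = complex.Re (g 0).
Proof.
rewrite /real_restriction; congr (complex.Re (g _)).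
by apply/rowP => j; rewrite !mxE.
Qed.

Lemma entire_coef_le_Cap :
  complex.Re (partials (ones n) f 0) <= Cap (real_restriction f).
Proof.
rewrite -real_restriction0 -{2}(partials0 f).
exact: (coef_le_Cap slc_log_concave slc_derive).
Qed.

Lemma entire_Cap_le_coef :
  expR (- n%:R) * Cap (real_restriction f) <= complex.Re (partials (ones n) f 0).
Proof.
rewrite -real_restriction0 -{1}(partials0 f).
have -> : expR (- n%:R) = \prod_(0 <= k < n) expR (- 1) :> R.
  by rewrite prodr_const_nat subn0 -expRM_natl mulrN1.
refine (@Cap_le_coef R n F slc_log_concave (fun=> expR (- 1)) _ _).
  by move=> i; exact: expR_ge0.
move=> i x C x0 C0; apply: exp_step => //.
- by move=> j; exact: (line_seq_lc slc_log_concave).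
- exact: (line_seq_derive slc_derive).
Qed.

End StronglyLogConcave.
End EntireFunctions.

Theorem theorem3p5 (R : realType) (n : nat) :
  (forall f : 'rV[R[i]]_n -> R[i]^o,
     entire f ->
     (forall c, 0 <= taylor_coef f c) ->
     strongly_log_concave f ->
     (expR (- n%:R) * Cap (real_restriction f))%:C <= partials (ones n) f 0
     /\ partials (ones n) f 0 <= (Cap (real_restriction f))%:C) /\
  (forall p : mpoly n R,
     p \is ishomog1 n mdeg ->
     (forall c, 0 <= mcoeff c p) ->
     poly_strongly_log_concave p ->
     n`!%:R / n%:R ^+ n * Cap (poly_fun p)
       <= poly_fun (mderivm (ones n) p) 0 <= Cap (poly_fun p)) /\
  (forall p : mpoly n R,
     msize p = n.+1 ->
     (forall c, 0 <= mcoeff c p) ->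
     poly_strongly_log_concave p ->
     (\prod_(1 <= i < n.+1) Lconst R i) * Cap (poly_fun p)
       <= poly_fun (mderivm (ones n) p) 0 <= Cap (poly_fun p)).
Proof.
split; last split=> p p_deg _ p_slc.
- move=> f f_entire f_coef f_slc.
  (* All factorials in this Taylor coefficient are 1, so the mixed derivative is nonnegative, hence
     real, and may be replaced by its real part. *)
  have coef0 : 0 <= partials (ones n) f 0.
    have := f_coef (ones n); rewrite /taylor_coef.
    by rewrite big1 ?divr1// => i _; rewrite mnmE.
  rewrite -(RRe_real (ger0_real coef0)) !lecR.
  by rewrite entire_coef_le_Cap// entire_Cap_le_coef.
- by rewrite poly_coef_le_Cap// poly_homog_Cap_le_coef.
- by rewrite poly_coef_le_Cap// poly_Cap_le_coef// p_deg.
Qed.
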